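(* Let $\mathbf A=\langle A,R,',1\rangle$ be an orthogonal relational system in which $R$ is reflexive and transitive. Then every groupoid $\langle A,+,',1\rangle$ induced by $\mathbf A$ is an orthogroupoid.
   Context: A relational system with 1 and involution is $\langle A,R,',1\rangle$ where $A\neq\emptyset$, $R\subseteq A^2$, $':A\to A$ satisfies $a''=a$ and $(a,b)\in R\Rightarrow(b',a')\in R$, and $(x,1)\in R$ for all $x\in A$; put $0=1'$. $U_R(a,b)=\{c:(a,c)\in R,(b,c)\in R\}$. Elements $a,b$ are orthogonal ($a\perp b$) if $(a,b')\in R$. An element $w\in U_R(a,b)$ is a supremal element for $a,b$ if $(w,z)\in R$ for all $z\in U_R(a,b)$ with $z\neq w$. The system is orthogonal if (a) $U_R(x,x')=\{1\}$ for every $x$, and (b) whenever $x\perp y$ and $x\neq 0\neq y$, a supremal element for $x,y$ exists. A groupoid induced by such a system is $\langle A,+,',1\rangle$ where $+$ satisfies: (i) if $(x,y)\in R$ then $x+y=y$; (ii) if $(x,y)\notin R$ and $(y,x)\in R$ then $x+y=x$; (iii) if $(x,y)\notin R$ and $(y,x)\notin R$ then $x+y=y+x=z$ for some arbitrarily chosen $z\in U_R(x,y)$; (iv) if $x\perp y$ with $x\neq 0\neq y$ then $x+y=y+x=w$ for a supremal element $w$ for $x,y$. An orthogroupoid is an algebra $\langle D,+,',1\rangle$ of type $(2,1,0)$, with $0:=1'$, satisfying: (a) $x''\approx x$; (b) $0+x\approx x$ and $x+1\approx 1$; (c) $x+x'\approx 1$; (d) for all $x,z$: if $x+z=z$ and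 $x'+z=z$ then $z=1$; (e) $(((z+y)'+(z+x))'+(z+y)')+z'\approx z'$; (f) $x+(x+y)\approx x+y$ and $y+(x+y)\approx x+y$. *)

(* Defs.v *)
From Stdlib Require Import Ensembles Relation_Definitions.

(* The carrier is nonempty because it contains [one]; [rel] is arbitrary here
   (neither reflexivity nor transitivity nor antisymmetry is assumed). *)
Record relSystem : Type := RelSystem {
  carrier :> Type;
  rel : relation carrier;
  inv : carrier -> carrier;
  one : carrier;
  inv_invol : forall a, inv (inv a) = a;
  rel_inv : forall a b, rel a b -> rel (inv b) (inv a);
  rel_one : forall x, rel x one
}.

Arguments rel {_} _ _.
Arguments inv {_} _.
Arguments one {_}.

Definition zero {A : relSystem} : A := inv one.

Definition upper {A : relSystem} (a b : A) : Ensemble A :=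
  fun c => rel a c /\ rel b c.

Definition perp {A : relSystem} (a b : A) : Prop := rel a (inv b).

Definition supremal {A : relSystem} (a b w : A) : Prop :=
  In A (upper a b) w /\
  forall z, In A (upper a b) z -> z <> w -> rel w z.

Definition orthogonal_system (A : relSystem) : Prop :=
  (forall x : A, Same_set A (upper x (inv x)) (Singleton A one)) /\
  (forall x y : A, perp x y -> x <> zero -> y <> zero ->
     exists w, supremal x y w).

Record induced_groupoid (A : relSystem) (add : A -> A -> A) : Prop := {
  induced_rel : forall x y : A, rel x y -> add x y = y;
  induced_rel_rev : forall x y : A, ~ rel x y -> rel y x -> add x y = x;
  induced_incomparable : forall x y : A, ~ rel x y -> ~ rel y x ->
    exists z, In A (upper x y) z /\ add x y = z /\ add y x = z;
  induced_perp : forall x y : A, perp x y -> x <> zero -> y <> zero ->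
    exists w, supremal x y w /\ add x y = w /\ add y x = w
}.

Record orthogroupoid (D : Type) (add : D -> D -> D) (neg : D -> D) (e : D)
  : Prop := {
  og_invol : forall x, neg (neg x) = x;
  og_zero_add : forall x, add (neg e) x = x;
  og_add_one : forall x, add x e = e;
  og_compl : forall x, add x (neg x) = e;
  og_join_compl : forall x z, add x z = z -> add (neg x) z = z -> z = e;
  og_orthomod : forall x y z,
    add (add (neg (add (neg (add z y)) (add z x))) (neg (add z y))) (neg z)
    = neg z;
  og_absorb_l : forall x y, add x (add x y) = add x y;
  og_absorb_r : forall x y, add y (add x y) = add x y
}.

(* Main.v *)
(** In an induced groupoid [x + y] is always an upper bound of [x] and [y], so
    [x + y = y] holds exactly when [(x, y)] is in [R]. For axiom (e), put
    [a = (z + y)'] and [u = a + (z + x)]. Then [u'] and [a] are orthogonal and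
    both lie below [z'], hence [u' + a], being supremal for them, lies below
    [z'] as well. *)

Require Import Defs.
From Stdlib Require Import Relation_Definitions Ensembles Classical.

Lemma rel_zero (A : relSystem) (x : A) : rel zero x.
Proof.
rewrite <- (inv_invol A x); apply rel_inv, rel_one.
Qed.

(** If [x] and [y] are comparable, the sum is one of them, and reflexivity supplies the bound for
    that one. *)
Lemma induced_upper (A : relSystem) (hrefl : reflexive A rel)
  (add : A -> A -> A) (hadd : induced_groupoid A add) (x y : A) :
  rel x (add x y) /\ rel y (add x y).
Proof.
destruct (classic (rel x y)) as [hxy | hxy].
- rewrite (induced_rel _ _ hadd _ _ hxy); auto.
- destruct (classic (rel y x)) as [hyx | hyx].
  + rewrite (induced_rel_rev _ _ hadd _ _ hxy hyx); auto.
  + destruct (induced_incomparable _ _ hadd _ _ hxy hyx)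
      as [z [hz [-> _]]]; exact hz.
Qed.

Lemma induced_add_eq_r (A : relSystem) (hrefl : reflexive A rel)
  (add : A -> A -> A) (hadd : induced_groupoid A add) (x y : A) :
  add x y = y <-> rel x y.
Proof.
split; [| apply (induced_rel _ _ hadd)].
intros e; generalize (proj1 (induced_upper A hrefl add hadd x y)).
now rewrite e.
Qed.

(** For nonzero [x] and [y] the sum is supremal; if one of them is [zero], the sum is [x] or [y]. *)
Lemma induced_perp_least (A : relSystem) (hrefl : reflexive A rel)
  (add : A -> A -> A) (hadd : induced_groupoid A add) (x y z : A) :
  perp x y -> rel x z -> rel y z -> rel (add x y) z.
Proof.
intros hp hx hy.
destruct (classic (x = zero)) as [-> | nx].
- now rewrite (induced_rel _ _ hadd _ _ (rel_zero A y)).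
- destruct (classic (y = zero)) as [-> | ny].
  + destruct (classic (rel x zero)) as [h | h].
    * now rewrite (induced_rel _ _ hadd _ _ h).
    * now rewrite (induced_rel_rev _ _ hadd _ _ h (rel_zero A x)).
  + destruct (induced_perp _ _ hadd _ _ hp nx ny) as [w [[_ hw] [-> _]]].
    (* [supremal] compares [w] only with other upper bounds; reflexivity covers [w] itself. *)
    destruct (classic (z = w)) as [-> | nz].
    * apply hrefl.
    * apply hw; [split |]; assumption.
Qed.

Lemma orthogonal_upper_compl (A : relSystem) (hA : orthogonal_system A)
  (x z : A) : rel x z -> rel (inv x) z -> z = one.
Proof.
intros h h'; destruct (proj1 (proj1 hA x) z (conj h h')); reflexivity.
Qed.

Theorem theorem2p15 (A : relSystem) (hA : orthogonal_system A)
  (hrefl : reflexive A rel) (htrans : transitive A rel)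
  (add : A -> A -> A) (hadd : induced_groupoid A add) :
  orthogroupoid A add inv one.
Proof.
pose proof (induced_upper A hrefl add hadd) as ub.
pose proof (induced_add_eq_r A hrefl add hadd) as addE.
split.
- apply inv_invol.
- intros x; apply addE, rel_zero.
- intros x; apply addE, rel_one.
- intros x; apply (orthogonal_upper_compl A hA x); apply ub.
- intros x z h h'.
  apply (orthogonal_upper_compl A hA x); apply addE; assumption.
- intros x y z; apply addE, (induced_perp_least A hrefl add hadd).
  + apply rel_inv, ub.
  (* Transitivity along [z], [z + x], [u] puts [z] below [u], so [u'] lies below [z']. *)
  + apply rel_inv, (htrans _ (add z x)); apply ub.
  + apply rel_inv, ub.
- intros x y; apply addE, ub.
- intros x y; apply addE, ub.
Qed.
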